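(* Suppose $n\ge 2$ and $\mathbb{Z}^n\curvearrowright X$ is a free Borel action of $\mathbb{Z}^n$ on a Polish space $X$. Then the Borel chromatic number of the Schreier graph on $X$ is $3$.
   Context: The standard generating set of $\mathbb{Z}^n$ is $\{\pm e_1,\dots,\pm e_n\}$, where $e_i$ has $i$-th coordinate $1$ and other coordinates $0$. The Schreier graph of an action $\mathbb{Z}^n\curvearrowright X$ (with respect to these generators) has vertex set $X$ and edges $(x,y)$ with $y=s\cdot x$ for some standard generator $s$. A proper coloring of a graph $G$ is a map $c$ from the vertices of $G$ to a cardinal $\kappa$ (given the discrete topology) such that $c(x)\ne c(y)$ whenever $x,y$ are adjacent. The Borel chromatic number of $G$ is the least countable cardinal $\kappa$ for which there is a Borel proper coloring $c:V(G)\to\kappa$.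
   Formalization: ''Is 3'' fails for some actions (Z^n translating itself is Borel 2-colorable by parity; empty X gives 0), so it is proved that the Borel chromatic number is at most 3 for every free Borel action and exactly 3 for some free Borel action, for each n ≥ 2. *)

(* Defs.v *)
From HB Require Import structures.
From mathcomp Require Import all_boot all_order all_algebra.
From mathcomp Require Import all_classical all_reals all_analysis.

Set Implicit Arguments.
Unset Strict Implicit.
Unset Printing Implicit Defensive.

Import Order.TTheory GRing.Theory Num.Theory.

Local Open Scope classical_set_scope.
Local Open Scope ring_scope.

Definition separable_space (X : topologicalType) : Prop :=
  exists2 D : set X, countable D & dense D.

(* The library's [completeType] would force the space to be pointed; here the
   empty space counts as Polish. *)
Definition complete_space (M : uniformType) : Prop :=
  forall F : set_system M, ProperFilter F -> cauchy F -> exists x : M, F --> x.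

Definition completely_metrizable (R : realType) (X : topologicalType) : Prop :=
  exists (M : metricType R) (f : X -> M) (g : M -> X),
    [/\ cancel f g, cancel g f, continuous f, continuous g & complete_space M].

Definition polish (R : realType) (X : topologicalType) : Prop :=
  separable_space X /\ completely_metrizable R X.

Definition borel (X : topologicalType) : set (set X) := <<s @open X >>.

Definition borel_fun (X Y : topologicalType) (f : X -> Y) : Prop :=
  forall B : set Y, borel B -> borel (f @^-1` B).

(* Z^n is ['rV[int]_n], written additively; as an acting group it is discrete. *)
Section Actions.
Variables (n : nat) (X : topologicalType).
Implicit Type a : 'rV[int]_n -> X -> X.

Definition is_action a : Prop :=
  (forall x, a 0 x = x) /\ (forall g h x, a (g + h) x = a g (a h x)).

Definition free_action a : Prop := forall g x, a g x = x -> g = 0.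

Definition borel_action a : Prop :=
  borel_fun (fun p : discrete_topology 'rV[int]_n * X => a p.1 p.2).

Definition free_borel_action a : Prop :=
  [/\ is_action a, free_action a & borel_action a].

Definition standard_generator (s : 'rV[int]_n) : Prop :=
  exists i : 'I_n, s = delta_mx 0 i \/ s = - delta_mx 0 i.

Definition schreier_graph a (x y : X) : Prop :=
  exists2 s, standard_generator s & y = a s x.

End Actions.

(* A countable cardinal: [Some k] is the finite cardinal k, [None] is aleph_0. *)
Definition countable_cardinal := option nat.

Definition colors (kappa : countable_cardinal) : set nat :=
  if kappa is Some k then `I_k else setT.

Definition cardinal_le (kappa lambda : countable_cardinal) : Prop :=
  (colors kappa #<= colors lambda)%card.

(* A graph on X is given by its adjacency relation E. *)
Section BorelColorings.
Variables (X : topologicalType) (E : X -> X -> Prop).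

Definition proper_coloring (c : X -> nat) : Prop :=
  forall x y, E x y -> c x <> c y.

Definition borel_colorable (kappa : countable_cardinal) : Prop :=
  exists c : X -> nat,
    [/\ forall x, colors kappa (c x), proper_coloring c & borel_fun c].

(* A relation, since a graph need not have a countable Borel coloring. *)
Definition borel_chromatic_number (kappa : countable_cardinal) : Prop :=
  borel_colorable kappa /\
  forall lambda, borel_colorable lambda -> cardinal_le kappa lambda.

End BorelColorings.

(* Main.v *)
(* Upper bound.  A 2-coloring by parity exists on every orbit, but has to be
   chosen in a Borel way.  On a Borel set whose components have bounded
   diameter each component has a Borel root, hence a Borel parity.  Maximal
   discrete sets give, at every scale s, a cover of X by 10^n + 1 sets whose
   s-components have diameter O(s); by pigeonhole one of these colors catches
   every point of a given orbit at some scale, so a rapidly growing sequence of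
   scales s_k yields a cover of X by single sets C_k.  Each C_k is enlarged to
   Z_k by absorbing the components of a neighborhood of the earlier boundaries
   that it meets; this has bounded effect, and makes the boundaries ("walls")
   of all the Z_k pairwise far apart.  So both the union of the walls and its
   complement carry a Borel parity, and the third color is used to pass from
   one parity to the other in a thin strip around the walls.

   Lower bound.  Let Z^n act on the real line by n rationally independent
   translations.  A 2-coloring is flipped by every odd element of Z^n, and odd
   elements act by arbitrarily small translations, which contradicts the Baire
   property of a color class. *)
Require Import Defs.
From mathcomp Require Import all_boot all_order all_algebra.
From mathcomp Require Import all_classical all_reals all_analysis.
From mathcomp Require Import zify ring lra.

Set Implicit Arguments.
Unset Strict Implicit.
Unset Printing Implicit Defensive.

Import Order.TTheory GRing.Theory Num.Theory.
Import numFieldNormedType.Exports.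

Local Open Scope classical_set_scope.

(** * Borel sets and functions with countably many values *)

Section BorelSets.
Variable X : topologicalType.
Implicit Types P Q : X -> Prop.

Lemma borel_not P : borel [set x | P x] -> borel [set x | ~ P x].
Proof. by move=> bP; have := sigma_algebraCD bP; rewrite setTD. Qed.

Lemma borel_const (p : Prop) : borel [set x : X | p].
Proof.
have b0 : borel [set x : X | False].
  have : borel (@set0 X) by apply: sigma_algebra0.
  by congr (borel _); apply/seteqP; split.
have [hp|hp] := EM p.
  by have := borel_not b0; congr (borel _); apply/seteqP; split => x //= _ [].
by have := b0; congr (borel _); apply/seteqP; split.
Qed.

Lemma borel_exists (T : countType) (F : T -> X -> Prop) :
  (forall t, borel [set x | F t x]) -> borel [set x | exists t, F t x].
Proof.
move=> bF.
pose G i := [set x | if unpickle i is Some t then F t x else False].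
have : borel (\bigcup_i G i).
  apply: sigma_algebra_bigcup => i; rewrite /G.
  by case: (unpickle i) => [t|]; [exact: bF|exact: borel_const].
congr (borel _); apply/seteqP; split=> x /=.
  by move=> [i _]; rewrite /G /=; case: (unpickle i) => // t Ft; exists t.
by move=> [t Ft]; exists (pickle t) => //; rewrite /G /= pickleK.
Qed.

Lemma borel_forall (T : countType) (F : T -> X -> Prop) :
  (forall t, borel [set x | F t x]) -> borel [set x | forall t, F t x].
Proof.
move=> bF.
have := borel_not (borel_exists (fun t => borel_not (bF t))).
congr (borel _); apply/seteqP; split=> x /=; last by move=> h [t]; apply.
by move=> h t; apply: contrapT => nF; apply: h; exists t.
Qed.

Lemma borel_or P Q : borel [set x | P x] -> borel [set x | Q x] ->
  borel [set x | P x \/ Q x].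
Proof.
move=> bP bQ.
have := @borel_exists bool (fun b x => if b then P x else Q x).
move=> /(_ (fun b => if b return borel [set x | if b then P x else Q x]
                     then bP else bQ)).
congr (borel _); apply/seteqP; split=> x /=; first by move=> [[]]; [left|right].
by move=> []; [exists true|exists false].
Qed.

Lemma borel_and P Q : borel [set x | P x] -> borel [set x | Q x] ->
  borel [set x | P x /\ Q x].
Proof.
move=> bP bQ; have := borel_not (borel_or (borel_not bP) (borel_not bQ)).
congr (borel _); apply/seteqP; split=> x /=; last by move=> [p q] [].
by move=> /not_orP[/contrapT p /contrapT q].
Qed.

Lemma borel_imp P Q : borel [set x | P x] -> borel [set x | Q x] ->
  borel [set x | P x -> Q x].
Proof.
move=> bP bQ; have := borel_or (borel_not bP) bQ.
congr (borel _); apply/seteqP; split=> x /=; first by case.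
by move=> pq; have [p|np] := EM (P x); [right; apply: pq|left].
Qed.

Lemma borel_iff P Q : borel [set x | P x] -> borel [set x | Q x] ->
  borel [set x | P x <-> Q x].
Proof. by move=> bP bQ; apply: borel_and; apply: borel_imp. Qed.

Definition borel_fibers (T : Type) (f : X -> T) : Prop :=
  forall t, borel [set x | f x = t].

(** Since [f] has countably many values, the set is a countable union over the value [t]. This lets
    later constructions depend on a Borel choice. *)
Lemma borel_subst (T : countType) (f : X -> T) (F : T -> X -> Prop) :
  borel_fibers f -> (forall t, borel [set x | F t x]) ->
  borel [set x | F (f x) x].
Proof.
move=> bf bF.
have := borel_exists (fun t => borel_and (bf t) (bF t)).
congr (borel _); apply/seteqP; split=> x /=; first by move=> [t [<-]].
by exists (f x).
Qed.

Lemma borel_preim (T : countType) (f : X -> T) (P : T -> Prop) :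
  borel_fibers f -> borel [set x | P (f x)].
Proof.
by move=> bf; apply: (@borel_subst T f (fun t _ => P t)) => // t; exact: borel_const.
Qed.

Lemma borel_fibers_comp (T : countType) (U : Type) (f : X -> T) (h : T -> U) :
  borel_fibers f -> borel_fibers (fun x => h (f x)).
Proof. by move=> bf u; exact: (borel_preim (fun t => h t = u)). Qed.

Lemma borel_fibers_pair (T U : Type) (f : X -> T) (h : X -> U) :
  borel_fibers f -> borel_fibers h -> borel_fibers (fun x => (f x, h x)).
Proof.
move=> bf bh [t u]; have := borel_and (bf t) (bh u).
by congr (borel _); apply/seteqP; split=> x /=; [move=> [-> ->]|move=> [-> ->]].
Qed.

Lemma borel_fibers_asbool P : borel [set x | P x] ->
  borel_fibers (fun x => `[< P x >]).
Proof.
move=> bP [].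
  by move: bP; congr (borel _); apply/seteqP; split=> x /asboolP.
have := borel_not bP.
by congr (borel _); apply/seteqP; split=> x /=; [move=> /asboolPn/negbTE|move=> /negbT/asboolPn].
Qed.

(* The selector takes, at each point, the witness with the least code. *)
Lemma borel_uniformization (T : countType) (t0 : T) (F : T -> X -> Prop) :
  (forall t, borel [set x | F t x]) ->
  exists f : X -> T, borel_fibers f /\ forall x, (exists t, F t x) -> F (f x) x.
Proof.
move=> bF.
pose least t x := F t x /\ forall u : T, (pickle u < pickle t)%N -> ~ F u x.
have leastE x : (exists t, F t x) -> exists t, least t x.
  move=> [t Ft].
  have ex : exists i, `[< exists2 u, pickle u = i & F u x >].
    by exists (pickle t); apply/asboolP; exists t.
  case: (ex_minnP ex) => i /asboolP[u <- Fu] imin.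
  exists u; split=> // v; rewrite ltnNge => /negP h Fv; apply: h; apply: imin.
  by apply/asboolP; exists v.
have least_inj t u x : least t x -> least u x -> t = u.
  move=> [Ft tmin] [Fu umin]; apply: (pcan_inj (@pickleK T)).
  by case: (ltngtP (pickle t) (pickle u)) => // [/umin|/tmin].
have [f fP] : {f : X -> T & forall x,
    least (f x) x \/ (~ (exists t, F t x)) /\ f x = t0}.
  apply: (@choice _ _ (fun x t => least t x \/ (~ (exists t, F t x)) /\ t = t0)).
  move=> x; have [/leastE[t ht]|h] := EM (exists t, F t x).
    by exists t; left.
  by exists t0; right.
exists f; split=> [t|x ex]; last first.
  by case: (fP x) => [[]//|[]].
have b1 : borel [set x | least t x].
  apply: borel_and => //; apply: borel_forall => u; apply: borel_imp.
    exact: borel_const.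
  exact: borel_not.
have b2 : borel [set x | ~ (exists t, F t x) /\ t = t0].
  by apply: borel_and; [apply: borel_not; exact: borel_exists|exact: borel_const].
have := borel_or b1 b2; congr (borel _); apply/seteqP; split=> x /=.
  case=> [lt|[nF ->]]; case: (fP x) => [lf|[nF' ->//]].
  - exact: least_inj lf lt.
  - by case: nF'; exists t; case: lt.
  - by case: nF; exists (f x); case: lf.
by move=> <-; exact: fP.
Qed.

End BorelSets.

Local Open Scope ring_scope.

(** * Boxes in Z^n *)

Section Boxes.
Variable n : nat.
Implicit Types g h : 'rV[int]_n.

Definition box (r : nat) g : Prop := forall i, (`|g 0%R i| <= r)%N.

Lemma box0 r : box r (0 : 'rV[int]_n).
Proof. by move=> i; rewrite mxE. Qed.

Lemma boxN r g : box r g -> box r (- g).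
Proof. by move=> bg i; rewrite mxE abszN. Qed.

Lemma boxD r s g h : box r g -> box s h -> box (r + s) (g + h).
Proof.
move=> bg bh i; rewrite mxE.
have : (`|(g 0 i + h 0 i)%R| <= r + s)%N by move: (bg i) (bh i); lia.
exact.
Qed.

Lemma boxB r s g h : box r g -> box s h -> box (r + s) (g - h).
Proof. by move=> bg /boxN; exact: boxD. Qed.

Lemma box_le r s g : (r <= s)%N -> box r g -> box s g.
Proof. by move=> rs bg i; exact: leq_trans (bg i) rs. Qed.

Lemma box_ex g : exists r, box r g.
Proof.
exists (\max_i `|g 0%R i|)%N => i.
apply: leq_bigmax.
Qed.

Lemma box_finite r : exists s : seq 'rV[int]_n, forall g, box r g -> g \in s.
Proof.
exists [seq \row_i ((f i : nat)%:Z - r%:Z) | f : {ffun 'I_n -> 'I_(r + r).+1}].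
move=> g bg; apply/mapP.
exists [ffun i => inord `|(g 0 i + r%:Z)%R|%N]; first by rewrite mem_enum.
apply/rowP => i; rewrite mxE ffunE inordK; last by move: (bg i); lia.
have : g 0 i = `|(g 0 i + r%:Z)%R|%N%:Z - r%:Z by move: (bg i); lia.
exact.
Qed.

Lemma box_bound r (P : 'rV[int]_n -> nat -> Prop) :
  (forall g, box r g -> exists j, P g j) ->
  exists N, forall g, box r g -> exists2 j, (j < N)%N & P g j.
Proof.
move=> Pex; have [s sP] := box_finite r.
have [N NP] : exists N, forall g, g \in s -> box r g -> exists2 j, (j < N)%N & P g j.
  elim: {sP} s => [|h s [N IH]]; first by exists 0%N.
  have [bh|nbh] := EM (box r h); last first.
    exists N => g; rewrite inE => /orP[/eqP-> //|]; exact: IH.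
  have [j Pj] := Pex _ bh.
  exists (maxn j.+1 N) => g; rewrite inE => /orP[/eqP-> _|gs bg].
    by exists j => //; rewrite leq_max leqnn.
  by have [i iN Pi] := IH _ gs bg; exists i => //; rewrite leq_max iN orbT.
by exists N => g bg; exact: NP (sP _ bg) bg.
Qed.

(** Coordinates shifted by [5 * r] lie between 0 and [10 * r]. Blocks of length [r.+1] cut the box
    into [10 ^ n] cells, and two points of one cell differ by at most [r] in every coordinate. *)
Lemma box_packing r m (g : 'I_m -> 'rV[int]_n) :
  (forall i, box (5 * r) (g i)) ->
  (forall i j, box r (g i - g j) -> i = j) -> (m <= 10 ^ n)%N.
Proof.
move=> bg sep.
pose cell i := [ffun k => inord (`|(g i 0 k + (5 * r)%:Z)%R|%N %/ r.+1)] :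
  {ffun 'I_n -> 'I_10}.
have cell_inj : injective cell.
  move=> i j /ffunP eq_ij; apply: sep => k.
  move: (eq_ij k); rewrite !ffunE => /(congr1 val) /=.
  have lt10 l : (`|(g l 0 k + (5 * r)%:Z)%R|%N %/ r.+1 < 10)%N.
    by rewrite ltn_divLR //; move: (bg l k); lia.
  rewrite !inordK // => eqd.
  suff : (`|(g i 0 k - g j 0 k)%R| <= r)%N by rewrite !mxE.
  move: (divn_eq `|(g i 0 k + (5 * r)%:Z)%R|%N r.+1) (divn_eq `|(g j 0 k + (5 * r)%:Z)%R|%N r.+1).
  rewrite eqd.
  move: (ltn_pmod `|(g i 0 k + (5 * r)%:Z)%R|%N (ltn0Sn r)).
  move: (ltn_pmod `|(g j 0 k + (5 * r)%:Z)%R|%N (ltn0Sn r)).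
  move: (bg i k) (bg j k) (_ %% _)%N (_ %% _)%N (_ %/ _ * _)%N; lia.
by have := leq_card cell cell_inj; rewrite card_ffun !card_ord.
Qed.

Definition parity g : bool := odd `|(\sum_i g 0 i)%R|%N.

Lemma parityD g h : parity (g + h) = parity g (+) parity h.
Proof.
rewrite /parity (eq_bigr (fun i => g 0 i + h 0 i)); last by move=> i _; rewrite mxE.
rewrite big_split /=.
by move: (\sum_i g 0 i) (\sum_i h 0 i) => x y; have : odd `|(x + y)%R| = odd `|x| (+) odd `|y| by lia.
Qed.

Lemma parityN g : parity (- g) = parity g.
Proof.
rewrite /parity (eq_bigr (fun i => - g 0 i)); last by move=> i _; rewrite mxE.
by rewrite sumrN abszN.
Qed.

Lemma parity_delta i : parity (delta_mx 0 i).
Proof.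
rewrite /parity (bigD1 i) //= big1 ?addr0 ?mxE ?eqxx // => j ji.
by rewrite mxE eqxx (negbTE ji).
Qed.

Lemma box_delta i : box 1 (delta_mx 0 i : 'rV[int]_n).
Proof. by move=> j; rewrite mxE; case: (_ && _). Qed.

Lemma standard_generator_box s : standard_generator s -> box 1 s.
Proof. by move=> [i [->|->]]; [|apply: boxN]; exact: box_delta. Qed.

Lemma standard_generator_parity s : standard_generator s -> parity s.
Proof. by move=> [i [->|->]]; rewrite ?parityN parity_delta. Qed.

End Boxes.

(** * Free actions *)

Section FreeActions.
Variables (n : nat) (X : topologicalType) (a : 'rV[int]_n -> X -> X).
Hypothesis act_a : is_action a.
Hypothesis free_a : free_action a.
Hypothesis borel_a : forall g (B : set X), borel B -> borel [set x | B (a g x)].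
(** Polishness enters the construction as a countable family of Borel sets separating points, which
    [polish_separating] supplies. *)
Variable O : nat -> set X.
Hypothesis borel_O : forall j, borel (O j).
Hypothesis sep_O : forall x y, x <> y -> exists j, O j x /\ ~ O j y.

Lemma act0 x : a 0 x = x. Proof. by case: act_a. Qed.

Lemma actD g h x : a g (a h x) = a (g + h) x. Proof. by case: act_a => _ ->. Qed.

Lemma actK g x : a (- g) (a g x) = x. Proof. by rewrite actD addNr act0. Qed.

Lemma borel_fibers_act (T : Type) (f : X -> T) g :
  borel_fibers f -> borel_fibers (fun x => f (a g x)).
Proof. by move=> bf t; exact: (borel_a g (bf t)). Qed.

(** The color of a point is an initial segment of its memberships in the [O j], long enough to tell
    it from the other points of its [r]-ball. There are countably many such finite sequences. *)
Lemma distance_coloring r :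
  exists c : X -> nat, borel_fibers c /\
    forall x g, box r g -> g <> 0 -> c (a g x) <> c x.
Proof.
pose F (s : seq bool) x :=
  (forall g, box r g -> g <> 0 ->
     exists j, [/\ (j < size s)%N, O j x & ~ O j (a g x)]) /\
  (forall j, (j < size s)%N -> (nth false s j <-> O j x)).
have bF s : borel [set x | F s x].
  apply: borel_and.
    apply: borel_forall => g; apply: borel_imp; first exact: borel_const.
    apply: borel_imp; first exact: borel_const.
    apply: borel_exists => j; rewrite (_ : mkset _ =
      [set x | (j < size s)%N /\ O j x /\ ~ O j (a g x)]); last first.
      by apply/seteqP; split=> x [] // ? [].
    apply: borel_and; first exact: borel_const.
    apply: borel_and; first exact: borel_O.
    by apply: borel_not; exact: (borel_a _ (borel_O _)).
  apply: borel_forall => j; apply: borel_imp; first exact: borel_const.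
  by apply: borel_iff; [exact: borel_const|exact: borel_O].
have [c [bc cP]] := borel_uniformization [::] bF.
exists (fun x => pickle (c x)); split; first exact: borel_fibers_comp.
have Fc x : F (c x) x.
  apply: cP.
  have [N NP] : exists N, forall g, box r g -> exists2 j, (j < N)%N &
      (g <> 0 -> O j x /\ ~ O j (a g x)).
    apply: box_bound => g _; have [->|g0] := EM (g = 0); first by exists 0%N.
    have [|j jP] := @sep_O x (a g x); first by move=> /esym /free_a.
    by exists j.
  exists (mkseq (fun j => `[< O j x >]) N); split; rewrite size_mkseq.
    move=> g bg g0; have [j jN jP] := NP _ bg; exists j.
    by have [] := jP g0.
  by move=> j jN; rewrite nth_mkseq //; split => /asboolP.
move=> x g bg g0 /(pcan_inj (@pickleK _)) cE.
have [sepx nx] := Fc x; have [_ ngx] := Fc (a g x).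
have [j [js Ojx nO]] := sepx _ bg g0.
by apply: nO; apply/ngx; rewrite cE //; apply/nx.
Qed.

(** Greedy choice along a distance coloring: distinct points of one color are never within [r], so
    all admissible points of that color can be added at once. *)
Lemma maximal_discrete r (U : set X) : borel U ->
  exists Y : set X, [/\ borel Y, Y `<=` U,
    (forall x g, box r g -> Y x -> Y (a g x) -> g = 0) &
    (forall x, U x -> exists2 g, box r g & Y (a g x))].
Proof.
move=> bU; have [c [bc cP]] := distance_coloring r.
pose Yk := fix Yk k : set X := if k is k'.+1 then
  [set x | Yk k' x \/ U x /\ c x = k' /\ forall g, box r g -> ~ Yk k' (a g x)]
  else set0.
have bY k : borel (Yk k).
  elim: k => [|k IH] /=; first exact: borel_const.
  apply: borel_or => //; apply: borel_and => //; apply: borel_and => //.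
  apply: borel_forall => g; apply: borel_imp; first exact: borel_const.
  by apply: borel_not; exact: borel_a.
have Ylt k x : Yk k x -> (c x < k)%N.
  elim: k => [//|k IH] /= [/IH/ltnW //|[_ [-> _]]]; exact: leqnn.
have Yle k l x : (k <= l)%N -> Yk k x -> Yk l x.
  move=> /subnK <-; elim: (l - k)%N => [//|i IH] /IH; rewrite addSn /=; by left.
have Yc k x : Yk k x -> Yk (c x).+1 x.
  by elim: k => [//|k IH] /= [/IH//|[Ux [ck h]]]; right; rewrite ck.
(* Of two conflicting points, the one of larger color is added later, when the other is already
   present. *)
have Ydisc x g k l : box r g -> Yk k x -> Yk l (a g x) -> (c (a g x) < c x)%N -> False.
  move=> bg /Yc /= [/Ylt|[_ [_ h]] /Yc Yg lt]; first by rewrite ltnn.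
  by apply: (h _ bg); apply: Yle Yg.
exists [set x | exists k, Yk k x]; split.
- by apply: borel_exists.
- by move=> x [k]; elim: k => [//|k IH] /= [/IH//|[]].
- move=> x g bg [k Yx] [l Yg]; apply: contrapT => g0.
  case: (ltngtP (c (a g x)) (c x)) => [lt|gt|]; last exact: cP.
    exact: Ydisc bg Yx Yg lt.
  by apply: (Ydisc (a g x) (- g) l k (boxN bg) Yg); rewrite actK.
- move=> x Ux; have [[g bg Yg]|nex] := EM (exists2 g, box r g & Yk (c x) (a g x)).
    by exists g => //; exists (c x).
  exists 0; first exact: box0.
  exists (c x).+1; rewrite act0 /=; right; split=> //; split=> // g bg Yg.
  by apply: nex; exists g.
Qed.

(* [a (rho x) x] is a chosen root of the [r]-component of [x] in [A]. *)
Definition rooting (r D : nat) (A : set X) (rho : X -> 'rV[int]_n) : Prop :=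
  [/\ borel_fibers rho, forall x, A x -> box D (rho x) &
      forall x g, box r g -> A x -> A (a g x) -> rho x = rho (a g x) + g].

Definition rooted r D A : Prop := exists rho, rooting r D A rho.

(** In round [i], a maximal [5 * r]-discrete set of centers is chosen among the points that the
    [r]-balls of earlier rounds miss. The [2 * r]-balls about the centers form [A i]: an [r]-step
    inside [A i] joins points whose centers are within [2 * r + r + 2 * r], hence equal. *)
Lemma bounded_cover r :
  exists A : nat -> set X, [/\ forall i, borel (A i),
    forall i, rooted r (2 * r) (A i) &
    forall x, exists2 i, (i < (10 ^ n).+1)%N & forall g, box r g -> A i (a g x)].
Proof.
have [F FP] : {F : set X -> set X & forall U, borel U ->
   [/\ borel (F U), F U `<=` U,
    (forall x g, box (5 * r) g -> F U x -> F U (a g x) -> g = 0) &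
    (forall x, U x -> exists2 g, box (5 * r) g & F U (a g x))]}.
  apply: (@choice _ _ (fun U Y => borel U -> [/\ borel Y, Y `<=` U,
    (forall x g, box (5 * r) g -> Y x -> Y (a g x) -> g = 0) &
    (forall x, U x -> exists2 g, box (5 * r) g & Y (a g x))])).
  move=> U; have [bU|nbU] := EM (borel U); last by exists set0.
  by have [Y YP] := maximal_discrete (5 * r) bU; exists Y.
pose V := fix V i : set X := if i is i'.+1 then
  [set x | V i' x \/ exists g, box r g /\ F [set y | ~ V i' y] (a g x)] else set0.
have bV i : borel [set x | ~ V i x].
  apply: borel_not; elim: i => [|i IH] /=; first exact: borel_const.
  apply: borel_or => //; apply: borel_exists => g.
  apply: borel_and; first exact: borel_const.
  by apply: borel_a; have [] := FP _ (borel_not IH).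
pose Y i := F [set y | ~ V i y].
have bY i : borel (Y i) by have [] := FP _ (bV i).
have Vle k l x : (k <= l)%N -> V k x -> V l x.
  move=> /subnK <-; elim: (l - k)%N => [//|i IH] /IH; rewrite addSn /=; by left.
have Vcov x : V (10 ^ n).+1 x.
  (* A point still uncovered would have a center of each of the [10 ^ n + 1] rounds within [5 * r];
     centers of different rounds are not within [r], which contradicts the packing bound. *)
  apply: contrapT => nV.
  have [g gP] : {g : 'I_(10 ^ n).+1 -> 'rV[int]_n &
      forall i, box (5 * r) (g i) /\ Y i (a (g i) x)}.
    apply: (@choice _ _ (fun (i : 'I_(10 ^ n).+1) g => box (5 * r) g /\ Y i (a g x))).
    move=> i; have [_ _ _ /(_ x)] := FP _ (bV i).
    case=> [Vi|g bg Yg]; first by apply: nV; apply: Vle Vi; exact: ltnW.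
    by exists g.
  have lt_sep (i j : 'I_(10 ^ n).+1) : (i < j)%N -> ~ box r (g i - g j).
    move=> ij bij; have [_ Yi] := gP i; have [_ Yj] := gP j.
    have [_ sub _ _] := FP _ (bV j); apply: (sub _ Yj).
    apply: (Vle i.+1) => //; right; exists (g i - g j); split=> //.
    by rewrite actD subrK.
  have : (10 ^ n < 10 ^ n)%N; last by rewrite ltnn.
  apply: (@box_packing n r _ g) => [i|i j bij]; first by case: (gP i).
  apply: val_inj; case: (ltngtP i j) => // lt.
    by case: (lt_sep _ _ lt).
  by case: (lt_sep _ _ lt); rewrite -opprB; exact: boxN.
exists (fun i => [set x | exists g, box (2 * r) g /\ Y i (a g x)]); split.
- move=> i; apply: borel_exists => g; apply: borel_and; first exact: borel_const.
  exact: borel_a.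
- move=> i; have [|rho [brho rhoP]] := @borel_uniformization X 'rV[int]_n 0
    (fun g x => box (2 * r) g /\ Y i (a g x)).
    by move=> g; apply: borel_and; [exact: borel_const|exact: borel_a].
  exists rho; split=> // [x /rhoP[]//|x g bg /rhoP[bx Yx] /rhoP[bgx Ygx]].
  have [_ _ disc _] := FP _ (bV i).
  apply/eqP; rewrite eq_sym -subr_eq0; apply/eqP.
  apply: (disc (a (rho x) x)) => //.
    apply: (@box_le n (2 * r + r + 2 * r)); first lia.
    by apply: boxB => //; exact: boxD.
  by move: Ygx; rewrite !actD subrK.
- move=> x.
  have : exists2 i, (i < (10 ^ n).+1)%N & exists g, box r g /\ Y i (a g x).
    move: (Vcov x); elim: (10 ^ n).+1 => [//|k IH] /= [/IH[i ik iP]|].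
      by exists i => //; exact: ltnW.
    by exists k.
  move=> [i ilt [h [bh Yh]]]; exists i => // g bg; exists (h - g); split.
    by rewrite mul2n -addnn; exact: boxB.
  by rewrite actD subrK.
Qed.

(* The least color whose sets contain arbitrarily large balls about a point
   is invariant under the action, so the components of the sets of this color
   do not mix with those of the other colors. *)
Lemma multiscale_cover (s : nat -> nat) : (forall k, (k <= s k)%N) ->
  exists C : nat -> set X, [/\ forall k, borel (C k),
    forall k, rooted (s k) (2 * s k) (C k) & forall x, exists k, C k x].
Proof.
move=> sge.
have [A AP] := choice (fun k => bounded_cover (s k)).
have bA k i : borel (A k i) by have [] := AP k.
have [rho rhoP] : {rho : nat * nat -> X -> 'rV[int]_n &
    forall p, rooting (s p.1) (2 * s p.1) (A p.1 p.2) (rho p)}.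
  apply: (@choice _ _ (fun p rho => rooting (s p.1) (2 * s p.1) (A p.1 p.2) rho)).
  by move=> p; have [_ /(_ p.2)] := AP p.1.
pose deep i x := forall d : nat, exists k : nat, forall g, box d g -> A k i (a g x).
have bdeep i : borel [set x | deep i x].
  apply: borel_forall => d; apply: borel_exists => k; apply: borel_forall => g.
  by apply: borel_imp; [exact: borel_const|exact: borel_a].
have deep_act i h x : deep i x -> deep i (a h x).
  move=> dx d; have [e be] := box_ex h; have [k kP] := dx (d + e)%N.
  by exists k => g bg; rewrite actD; apply: kP; exact: boxD.
have deep_ex x : exists i, deep i x.
  apply: contrapT => nd.
  have [d dP] : {d : nat -> nat & forall i, forall k, ~ forall g, box (d i) g -> A k i (a g x)}.
    apply: (@choice _ _ (fun i d => forall k, ~ forall g, box d g -> A k i (a g x))).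
    move=> i; apply: contrapT => h; apply: nd; exists i => d.
    apply: contrapT => h'; apply: h; exists d => k kP; apply: h'; by exists k.
  (* At this scale the balls provided by [AP k] have radius [s k], which is at least every [d i], so
     one color contradicts the choice of its [d i]. *)
  pose k := (\max_(i < (10 ^ n).+1) d i)%N.
  have [_ _ /(_ x) [i ilt iP]] := AP k.
  apply: (dP i k) => g bg; apply: iP; apply: box_le bg.
  apply: leq_trans (sge k).
  exact: (leq_bigmax (F := fun i : 'I_(10 ^ n).+1 => d i) (Ordinal ilt)).
pose first_deep i x := deep i x /\ forall j, (j < i)%N -> ~ deep j x.
have [|col [bcol colP]] := @borel_uniformization X nat 0%N first_deep.
  move=> i; apply: borel_and => //; apply: borel_forall => j.
  by apply: borel_imp; [exact: borel_const|exact: borel_not].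
have {}colP x : first_deep (col x) x.
  apply: colP.
  have ex : exists i, `[< deep i x >] by have [i ?] := deep_ex x; exists i; apply/asboolP.
  case: (ex_minnP ex) => i /asboolP di imin; exists i; split=> // j.
  by rewrite ltnNge => /negP h dj; apply: h; apply: imin; apply/asboolP.
have col_le g x : (col (a g x) <= col x)%N.
  rewrite leqNgt; apply/negP => lt.
  have [_ /(_ _ lt)] := colP (a g x); apply; apply: deep_act.
  by have [] := colP x.
have col_act g x : col (a g x) = col x.
  by apply/eqP; rewrite eqn_leq col_le -{1}[x](actK g) col_le.
exists (fun k => [set x | A k (col x) x]); split.
- by move=> k; exact: (@borel_subst _ nat col (fun i x => A k i x) bcol (bA k)).
- move=> k; exists (fun x => rho (k, col x) x); split.
  + move=> t; apply: (@borel_subst _ nat col (fun i x => rho (k, i) x = t)) => // i.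
    by case: (rhoP (k, i)).
  + by move=> x Ax; case: (rhoP (k, col x)) => _ + _; apply.
  + move=> x g bg Ax; rewrite /= col_act => Agx.
    by case: (rhoP (k, col x)) => _ _; apply.
- move=> x; have [/(_ 0%N)[k kP] _] := colP x; exists k => /=.
  by rewrite -{2}[x]act0; apply: kP; exact: box0.
Qed.

(** * Neighborhoods and unions of rooted sets *)

Definition fatten (t : nat) (B : set X) : set X :=
  [set x | exists g, box t g /\ B (a g x)].

Lemma borel_fatten t B : borel B -> borel (fatten t B).
Proof.
move=> bB; apply: borel_exists => g; apply: borel_and; first exact: borel_const.
exact: borel_a.
Qed.

Lemma fatten_sub t B C : B `<=` C -> fatten t B `<=` fatten t C.
Proof. by move=> BC x [g [bg /BC Cg]]; exists g. Qed.

Lemma fattenD t u B : fatten t (fatten u B) `<=` fatten (u + t) B.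
Proof.
move=> x [g [bg [h [bh Bh]]]]; exists (h + g); split; first exact: boxD.
by rewrite -actD.
Qed.

(** Each point of [B] moves to a chosen nearby point of [C] and uses the root there; an [r]-step in
    [B] becomes a step of size at most [t + r + t] in [C]. *)
Lemma rooting_fatten r s t D C B rho : borel C -> rooting s D C rho ->
  B `<=` fatten t C -> (t + t + r <= s)%N -> exists rho', rooting r (D + t) B rho'.
Proof.
move=> bC [brho Drho rhoP] BC le_s.
have [|h [bh hP]] := @borel_uniformization X 'rV[int]_n 0
    (fun g x => box t g /\ C (a g x)).
  by move=> g; apply: borel_and; [exact: borel_const|exact: borel_a].
exists (fun x => rho (a (h x) x) + h x); split.
- move=> u.
  apply: (@borel_subst _ 'rV[int]_n h (fun g x => rho (a g x) + g = u)) => // g.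
  exact: (borel_preim (fun v => v + g = u) (borel_fibers_act g brho)).
- by move=> x /BC/hP[bhx /Drho Dx]; exact: boxD.
- move=> x g bg /BC/hP[bhx Chx] /BC/hP[bhg Chg].
  rewrite (rhoP _ (h (a g x) + g - h x)) //.
  + by rewrite !actD subrK -addrA subrK addrA.
  + apply: (@box_le n (t + r + t)); first lia.
    by apply: boxB => //; exact: boxD.
  + by rewrite actD subrK -actD.
Qed.

(* Points of [S] with the same root count as one component, and the components
   that meet [B] are added to it. *)
Definition absorb (S : set X) (rho : X -> 'rV[int]_n) (B : set X) : set X :=
  [set x | B x \/ S x /\ exists g, [/\ S (a g x), rho x = rho (a g x) + g & B (a g x)]].

Lemma borel_absorb S rho B : borel S -> borel_fibers rho -> borel B ->
  borel (absorb S rho B).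
Proof.
move=> bS brho bB; apply: borel_or => //; apply: borel_and => //.
apply: borel_exists => g.
have bE : borel [set x | rho x = rho (a g x) + g].
  have := borel_fibers_pair brho (borel_fibers_act g brho).
  exact: (borel_preim (fun p : 'rV[int]_n * 'rV[int]_n => p.1 = p.2 + g)).
have := borel_and (borel_a g bS) (borel_and bE (borel_a g bB)).
by congr (borel _); apply/seteqP; split=> x [] // ? [].
Qed.

Lemma absorb_fatten r D S rho B : rooting r D S rho ->
  absorb S rho B `<=` fatten (2 * D) B.
Proof.
move=> [_ Drho _] x [Bx|[Sx [g [Sg e Bg]]]].
  by exists 0; split; [exact: box0|rewrite act0].
exists g; split=> //.
have -> : g = rho x - rho (a g x) by rewrite e [X in X - _]addrC addrK.
by rewrite mul2n -addnn; apply: boxB; exact: Drho.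
Qed.

Lemma absorb_saturated r D S rho B x g : rooting r D S rho ->
  box r g -> S x -> S (a g x) -> absorb S rho B x <-> absorb S rho B (a g x).
Proof.
move=> [_ _ rhoP].
suff {x g} one x g : box r g -> S x -> S (a g x) ->
    absorb S rho B x -> absorb S rho B (a g x).
  move=> bg Sx Sg; split; first exact: one.
  by move=> /(one (a g x) (- g) (boxN bg) Sg); rewrite actK; apply.
move=> bg Sx Sg; have e := rhoP _ _ bg Sx Sg.
have eN : rho (a g x) = rho x - g by rewrite e addrK.
case=> [Bx|[_ [h [Sh eh Bh]]]]; right; split=> //.
  by exists (- g); rewrite actK.
by exists (h - g); rewrite actD subrK eN eh addrA.
Qed.

(** The components of [S] meeting the [r]-neighborhood of [B] are merged with that neighborhood into
    [B'], which stays close enough to [C] to take roots from it. The rest of [S] keeps its own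
    roots, since no [r]-step inside the union joins it to [B']. *)
Lemma rooted_union r D S s t D' C B : borel S -> borel C -> borel B ->
  rooted r D S -> rooted s D' C -> B `<=` fatten t C ->
  (2 * (t + r + 2 * D) + r <= s)%N -> (D <= D')%N ->
  rooted r (D' + (t + r + 2 * D)) (S `|` B).
Proof.
move=> bS bC bB [rho rhoP] [rhoC rhoCP] BC le_s leD.
pose B' := absorb S rho (fatten r B).
have bB' : borel B'.
  by apply: borel_absorb => //; [case: rhoP|exact: borel_fatten].
have B'C : B' `<=` fatten (t + r + 2 * D) C.
  by move=> x /(absorb_fatten rhoP)/(fatten_sub (fatten_sub BC))/(fatten_sub (@fattenD _ _ _))/fattenD.
have [|rhoB rhoBP] := rooting_fatten (r := r) bC rhoCP B'C; first by lia.
have B_B' x : B x -> B' x.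
  by move=> Bx; left; exists 0; split; [exact: box0|rewrite act0].
have sat x g : box r g -> (S `|` B) x -> (S `|` B) (a g x) -> B' x -> B' (a g x).
  move=> bg SBx [Sg|/B_B' //].
  case: SBx => [Sx|Bx]; first by move/(absorb_saturated _ rhoP bg Sx Sg).
  move=> _; left; exists (- g); split; first exact: boxN.
  by rewrite actK.
exists (fun x => if `[< B' x >] then rhoB x else rho x); split.
- have b3 : borel_fibers (fun x => ((`[< B' x >], rhoB x), rho x)).
    apply: borel_fibers_pair; last by case: rhoP.
    by apply: borel_fibers_pair; [exact: borel_fibers_asbool|case: rhoBP].
  exact: (borel_fibers_comp (fun p : bool * 'rV[int]_n * 'rV[int]_n =>
    if p.1.1 then p.1.2 else p.2) b3).
- move=> x SBx; case: asboolP => [B'x|nB'].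
    by case: rhoBP => _ + _; apply.
  case: SBx => [Sx|/B_B' //]; apply: (@box_le n D); first lia.
  by case: rhoP => _ + _; apply.
- move=> x g bg SBx SBg; case: asboolP => [B'x|nB']; case: asboolP => [B'g|nB'g].
  + by case: rhoBP => _ _; apply.
  + by case: nB'g; exact: sat B'x.
  + by case: nB'; move: (sat _ _ (boxN bg) SBg); rewrite actK; apply.
  + case: SBx => [Sx|/B_B' //]; case: SBg => [Sg|/B_B' //].
    by case: rhoP => _ _; apply.
Qed.

(** * Pairwise separated walls *)

Definition boundary (Z : set X) : set X :=
  [set x | Z x /\ exists g, box 1 g /\ ~ Z (a g x)].

Lemma borel_boundary Z : borel Z -> borel (boundary Z).
Proof.
move=> bZ; apply: borel_and => //; apply: borel_exists => g.
apply: borel_and; first exact: borel_const.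
by apply: borel_not; exact: borel_a.
Qed.

(** [S] stands for the neighborhood of the walls built so far. Absorbing into [C] the components of
    [S] that it meets keeps the new wall from cutting through any of them. *)
Lemma wall_step D S C : borel S -> borel C -> rooted 6 D S ->
  rooted (8 * D + 40) (2 * (8 * D + 40)) C ->
  exists Z : set X, [/\ borel Z, C `<=` Z, exists D', rooted 6 D' Z,
    forall x g, box 6 g -> S x -> S (a g x) -> (Z x <-> Z (a g x)) &
    rooted 6 (20 * D + 92) (S `|` fatten 6 (boundary Z))].
Proof.
move=> bS bC [rho rhoP] [rhoC rhoCP].
pose Z := absorb S rho C.
have bZ : borel Z by apply: borel_absorb => //; case: rhoP.
have ZC : Z `<=` fatten (2 * D) C := absorb_fatten rhoP.
exists Z; split=> //.
- by move=> x Cx; left.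
- have [|rhoZ rhoZP] := rooting_fatten (r := 6) bC rhoCP ZC; first by lia.
  by exists (2 * (8 * D + 40) + 2 * D)%N, rhoZ.
- by move=> x g bg Sx Sg; exact: (absorb_saturated _ rhoP bg Sx Sg).
(* The new neighborhood lies within [(2 * D) + 6] of [C], which is the parameter [t] of
   [rooted_union]; its scale condition then reads [8 * D + 30 <= 8 * D + 40]. *)
have -> : (20 * D + 92 = 2 * (8 * D + 40) + ((2 * D + 6) + 6 + 2 * D))%N by lia.
apply: (@rooted_union _ _ S (8 * D + 40) (2 * D + 6) _ C) => //.
- exact: (borel_fatten _ (borel_boundary _)).
- by exists rho.
- by exists rhoC.
- by move=> x; move/(fatten_sub (fun y (By : boundary Z y) => ZC _ (proj1 By)))/fattenD.
- by lia.
- by lia.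
Qed.

Lemma separated_walls :
  exists Z : nat -> set X, [/\ forall k, borel (Z k),
    forall k, exists D, rooted 6 D (Z k), forall x, exists k, Z k x &
    forall j k x g, (j < k)%N -> boundary (Z j) x -> box 6 g ->
      (Z k x <-> Z k (a g x))].
Proof.
(* The root bounds of the wall neighborhoods obey a recursion independent of the sets, so all scales
   can be fixed before the construction starts. *)
pose bound := fix bound k := if k is k'.+1 then (20 * bound k' + 92)%N else 0%N.
have bound_ge k : (k <= bound k)%N by elim: k => //= k IH; lia.
have [|C [bC rC covC]] := @multiscale_cover (fun k => 8 * bound k + 40)%N.
  by move=> k; move: (bound_ge k); lia.
pose spec k (S Z : set X) := [/\ borel Z, C k `<=` Z, exists D', rooted 6 D' Z,
    forall x g, box 6 g -> S x -> S (a g x) -> (Z x <-> Z (a g x)) &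
    rooted 6 (bound k.+1) (S `|` fatten 6 (boundary Z))].
have [F FP] : {F : nat * set X -> set X & forall p,
    borel p.2 /\ rooted 6 (bound p.1) p.2 -> spec p.1 p.2 (F p)}.
  apply: (@choice _ _ (fun p Z =>
    borel p.2 /\ rooted 6 (bound p.1) p.2 -> spec p.1 p.2 Z)).
  move=> [k S] /=; have [[bS rS]|nS] := EM (borel S /\ rooted 6 (bound k) S).
    by have [Z ZP] := wall_step bS (bC k) rS (rC k); exists Z.
  by exists set0.
pose S := fix S k : set X :=
  if k is k'.+1 then S k' `|` fatten 6 (boundary (F (k', S k'))) else set0.
have SP k : borel (S k) /\ rooted 6 (bound k) (S k).
  elim: k => [|k IH] /=.
    split; first exact: borel_const.
    by exists (fun=> 0); split=> // t; exact: borel_const.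
  have [bZ _ _ _ rS] := FP (k, S k) IH; split=> //.
  by apply: borel_or; [case: IH|exact: (borel_fatten _ (borel_boundary _))].
pose Z k := F (k, S k).
have ZP k : spec k (S k) (Z k) := FP (k, S k) (SP k).
exists Z; split.
- by move=> k; case: (ZP k).
- by move=> k; case: (ZP k).
- by move=> x; have [k Cx] := covC x; exists k; case: (ZP k) => _ + _ _ _; apply.
- move=> j k x g jk Wx bg.
  (* The 6-ball about a point of the wall of [Z j] enters [S] at stage [j.+1] and stays there. *)
  have SW h : box 6 h -> S k (a h x).
    move=> bh; move: jk => /subnK <-.
    elim: (k - j.+1)%N => [|i IH]; last by rewrite addSn /=; left.
    right; exists (- h); split; first exact: boxN.
    by rewrite actK.
  have [_ _ _ sat _] := ZP k; apply: sat => //; last exact: SW.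
  by rewrite -[x]act0; apply: SW; exact: box0.
Qed.

(* [p] is consistent because the walls are pairwise apart, and [v] because a
   step between two points off the walls crosses none of them, so the first
   [Z k] containing the point does not change. *)
Lemma wall_decomposition :
  exists (W : set X) (p v : X -> bool), [/\ borel W, borel_fibers p,
    borel_fibers v,
    forall x g, box 5 g -> W x -> W (a g x) -> p x = p (a g x) (+) parity g &
    forall x g, box 1 g -> ~ W x -> ~ W (a g x) -> v x = v (a g x) (+) parity g].
Proof.
have [Z [bZ rZ covZ sat]] := separated_walls.
have [rho rhoP] : {rho : nat -> X -> 'rV[int]_n & forall k,
    exists D, rooting 6 D (Z k) (rho k)}.
  apply: (@choice _ _ (fun k rho => exists D, rooting 6 D (Z k) rho)) => k.
  by have [D [rho rhoP]] := rZ k; exists rho, D.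
have brho k : borel_fibers (rho k) by have [D []] := rhoP k.
have bW k : borel (boundary (Z k)) := borel_boundary (bZ k).
(* If [j < k], then [Z k] is constant on the 6-ball about a point of the wall of [Z j]. A point
   within 5 of it has all its neighbors in that ball, so it is not on the wall of [Z k]. *)
have apart x g j k : box 5 g -> boundary (Z j) x -> boundary (Z k) (a g x) -> j = k.
  suff {x g j k} lt_apart x g j k : (j < k)%N -> box 5 g ->
      boundary (Z j) x -> ~ boundary (Z k) (a g x).
    move=> bg Wx Wg; case: (ltngtP j k) => // lt.
      by case: (lt_apart _ _ _ _ lt bg Wx).
    by case: (lt_apart _ _ _ _ lt (boxN bg) Wg); rewrite actK.
  move=> lt bg Wx [Zg [h [bh nZ]]]; apply: nZ.
  have bhg : box 6 (h + g) := boxD bh bg.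
  have bg6 : box 6 g by apply: box_le bg.
  by rewrite actD; apply/(sat j k x _ lt Wx bhg)/(sat j k x _ lt Wx bg6).
(* Where nearby points always get the same index [k], the parity of the vector to the root in [Z k]
   is a consistent parity. *)
have labelling (F : nat -> X -> Prop) (s : nat) : (s <= 6)%N ->
    (forall k, borel [set x | F k x]) -> (forall k x, F k x -> Z k x) ->
    (forall x g j k, box s g -> F j x -> F k (a g x) -> j = k) ->
    exists e : X -> bool, borel_fibers e /\ forall x g, box s g ->
      (exists k, F k x) -> (exists k, F k (a g x)) ->
      e x = e (a g x) (+) parity g.
  move=> s6 bF FZ Finj; have [k [bk kP]] := borel_uniformization 0%N bF.
  exists (fun x => parity (rho (k x) x)); split.
    move=> t; apply: (@borel_subst _ nat k (fun i x => parity (rho i x) = t)) => // i.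
    exact: (borel_preim (fun u => parity u = t)).
  move=> x g bg /kP Fx /kP Fg; have e := Finj _ _ _ _ bg Fx Fg.
  have [D [_ _ rP]] := rhoP (k x).
  rewrite (rP x g); first by rewrite parityD -e.
  - exact: box_le bg.
  - exact: FZ.
  - by apply: FZ; rewrite e.
have [p [bp pP]] := labelling (fun k x => boundary (Z k) x) 5%N isT bW
  (fun k x Wx => proj1 Wx) apart.
pose first k x := Z k x /\ forall j, (j < k)%N -> ~ Z j x.
pose W := [set x | exists k, boundary (Z k) x].
have firstE x : exists k, first k x.
  have ex : exists k, `[< Z k x >] by have [k ?] := covZ x; exists k; apply/asboolP.
  case: (ex_minnP ex) => k /asboolP Zk kmin; exists k; split=> // j.
  by rewrite ltnNge => /negP h Zj; apply: h; apply: kmin; apply/asboolP.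
have [|||v [bv vP]] := labelling (fun k x => ~ W x /\ first k x) 1%N isT.
- move=> k; apply: borel_and; first by apply: borel_not; exact: borel_exists.
  apply: borel_and; first exact: bZ.
  apply: borel_forall => j; apply: borel_imp; first exact: borel_const.
  by apply: borel_not; exact: bZ.
- by move=> k x [_ []].
(* A point of [Z j] off its wall has all its neighbors in [Z j], so the first index cannot increase
   along a step; by symmetry it is constant. *)
- suff le x g j k : box 1 g -> ~ W x -> first j x -> first k (a g x) -> (k <= j)%N.
    move=> x g j k bg [nWx fx] [nWg fg]; apply/eqP; rewrite eqn_leq.
    rewrite (le x g j k) // andbT; apply: (le (a g x) (- g)) => //.
      exact: boxN.
    by rewrite actK.
  move=> bg nW [Zj _] [_ kmin]; rewrite leqNgt; apply/negP => /kmin nZ.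
  by apply: nW; exists j; split=> //; exists g.
exists W, p, v; split=> //; first exact: borel_exists.
move=> x g bg nWx nWg; apply: vP => //.
  by have [k fk] := firstE x; exists k.
by have [k fk] := firstE (a g x); exists k.
Qed.

(* [w], [n1], [n2] say that the point is within 0, 1, 2 of the walls. Moving
   away from them, the points with [p = 0] and [p = 1] get the colors (0, 1),
   (2, 1), (2, 0) and finally (1, 0), one change at a time. *)
Definition interpolate (w n1 n2 p v : bool) : nat :=
  (if w then p : nat else if p == v then v : nat
   else if n1 then (if p then 1 else 2)
   else if n2 then (if p then 0 else 2) else v)%N.

(** The parity [p0] of the walls is extended to [p] on their 2-neighborhood, where it is
    interpolated with the outer parity [v]. *)
Lemma three_coloring : exists c : X -> nat, [/\ forall x, (c x < 3)%N,
  proper_coloring (schreier_graph a) c & borel_fibers c].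
Proof.
have [W [p0 [v [bW bp0 bv p0P vP]]]] := wall_decomposition.
pose F b x := forall g, box 2 g -> W (a g x) -> b = p0 (a g x) (+) parity g.
have [|p [bp pP]] := borel_uniformization false (F := F).
  move=> b; apply: borel_forall => g; apply: borel_imp; first exact: borel_const.
  apply: borel_imp; first exact: borel_a.
  exact: (borel_preim (fun c => b = c (+) parity g) (borel_fibers_act g bp0)).
have {}pP x g : box 2 g -> W (a g x) -> p x = p0 (a g x) (+) parity g.
  move=> bg Wg; apply: (pP x) => //; exists (p0 (a g x) (+) parity g) => h bh Wh.
  have e : a h x = a (h - g) (a g x) by rewrite actD subrK.
  rewrite (p0P (a g x) (h - g)).
  - rewrite -e parityD parityN; case: (p0 _); case: (parity h); by case: (parity g).
  - by apply: (@box_le n (2 + 2)) => //; exact: boxB.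
  - by [].
  - by rewrite -e.
have p_flip x s : box 1 s -> fatten 2 W x -> fatten 2 W (a s x) ->
    p x = p (a s x) (+) parity s.
  move=> bs [g [bg Wg]] [h [bh Wh]].
  rewrite (pP _ _ bg Wg) (pP _ _ bh Wh).
  have e : a h (a s x) = a (h + s - g) (a g x) by rewrite !actD subrK.
  (* The two wall points differ by at most 2 + 1 + 2, which is the range 5 on which [p0] is
     consistent. *)
  rewrite (p0P (a g x) (h + s - g)).
  - rewrite -e !parityD parityN.
    case: (p0 _); case: (parity h); case: (parity g); by case: (parity s).
  - apply: (@box_le n (2 + 1 + 2)) => //; apply: boxB => //; exact: boxD.
  - by [].
  - by rewrite -e.
(* Beyond the 2-neighborhood [interpolate] returns [v] whatever the value of [p], so the arbitrary
   choice of [p] there is harmless. *)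
pose c x := interpolate `[< W x >] `[< fatten 1 W x >] `[< fatten 2 W x >] (p x) (v x).
exists c; split.
- move=> x; rewrite /c /interpolate.
  by do ![case: ifP => _ //]; case: (p x); case: (v x).
(* By symmetry of the graph one endpoint may be taken off the walls; an edge inside [W] is colored
   by [p] alone. *)
- suff half x s : standard_generator s -> ~ W (a s x) -> c x <> c (a s x).
    move=> x _ [s gs ->]; have [Ws|/(half x s gs)//] := EM (W (a s x)).
    have [Wx|nWx] := EM (W x); last first.
      have gN : standard_generator (- s).
        by have [i [->|->]] := gs; exists i; rewrite ?opprK; [right|left].
      by move=> /esym; have := half (a s x) (- s) gN; rewrite actK; apply.
    have bs := standard_generator_box gs.
    have fatten2 y : W y -> fatten 2 W y.
      by move=> Wy; exists 0; split; [exact: box0|rewrite act0].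
    rewrite /c /interpolate !asboolT // (p_flip x s) //; try exact: fatten2.
    by rewrite (standard_generator_parity gs); case: (p _).
  move=> gs nWs; have bs := standard_generator_box gs.
  have ps := standard_generator_parity gs.
  have fatten_le i j y : (i <= j)%N -> fatten i W y -> fatten j W y.
    by move=> ij [g [bg Wg]]; exists g; split=> //; exact: box_le bg.
  have fattenW y : W y -> fatten 1 W y.
    by move=> Wy; exists 0; split; [exact: box0|rewrite act0].
  have fatten_fwd i y : fatten i W (a s y) -> fatten i.+1 W y.
    by move=> [g [bg Wg]]; exists (g + s); rewrite -actD -addn1; split => //; exact: boxD.
  have fatten_bwd i y : fatten i W y -> fatten i.+1 W (a s y).
    move=> Ny; have : fatten i W (a (- s) (a s y)) by rewrite actK.
    move=> [g [bg]]; rewrite actD => Wg; exists (g - s); split => //.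
    by rewrite -addn1; exact: boxB.
  rewrite /c /interpolate (asboolF nWs).
  have [Wx|nWx] := EM (W x).
    have n1 : fatten 1 W (a s x).
      by apply: fatten_bwd; exists 0; split; [exact: box0|rewrite act0].
    rewrite asboolT // (asboolT n1) (p_flip x s) ?ps //.
    + by case: (p _); case: (v _).
    + by apply: (fatten_le 1%N) => //; exact: fattenW.
    + exact: (fatten_le 1%N).
  rewrite asboolF // (vP x s) // ps.
  have [n1x|n1x] := EM (fatten 1 W x).
    have n2s := fatten_bwd _ _ n1x.
    rewrite (asboolT n1x) (asboolT n2s) (p_flip x s) ?ps //; last exact: (fatten_le 1%N).
    by case: asboolP => _; case: (p _); case: (v _).
  have [n1s|n1s] := EM (fatten 1 W (a s x)).
    have n2x := fatten_fwd _ _ n1s.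
    rewrite (asboolF n1x) (asboolT n1s) (asboolT n2x) (p_flip x s) ?ps //; last exact: (fatten_le 1%N).
    by case: (p _); case: (v _).
  rewrite (asboolF n1x) (asboolF n1s).
  have [n2x|n2x] := EM (fatten 2 W x); have [n2s|n2s] := EM (fatten 2 W (a s x)).
  - rewrite (asboolT n2x) (asboolT n2s) (p_flip x s) ?ps //.
    by case: (p _); case: (v _).
  - rewrite (asboolT n2x) (asboolF n2s).
    by case: (p x); case: (p _); case: (v _).
  - rewrite (asboolF n2x) (asboolT n2s).
    by case: (p x); case: (p _); case: (v _).
  - rewrite (asboolF n2x) (asboolF n2s).
    by case: (p x); case: (p _); case: (v _).
- have b5 : borel_fibers (fun x =>
      (((((`[< W x >], `[< fatten 1 W x >]), `[< fatten 2 W x >]), p x), v x))).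
    have bN t : borel_fibers (fun x => `[< fatten t W x >]).
      exact: borel_fibers_asbool (borel_fatten _ bW).
    have bW' := borel_fibers_asbool bW.
    by do ![apply: borel_fibers_pair => //].
  exact: (borel_fibers_comp (fun q : bool * bool * bool * bool * bool =>
    interpolate q.1.1.1.1 q.1.1.1.2 q.1.1.2 q.1.2 q.2) b5).
Qed.

End FreeActions.

(** * Polish spaces and Borel maps *)

Lemma metric_ball_open (R : realType) (M : metricType R) (X : topologicalType)
  (f : X -> M) (p : M) (r : R) : continuous f ->
  open [set x | mdist p (f x) < r].
Proof.
move=> cf; rewrite openE => x /= px.
apply: (cf x [set z | mdist p z < r]); apply/nbhs_ballP.
exists (r - mdist p (f x)); first by rewrite /= subr_gt0.
move=> z; rewrite ballEmdist /= ltrBrDl => h.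
exact: le_lt_trans (metric_triangle _ _ _) h.
Qed.

(** The separating sets are the balls of radius [1 / (k + 1)] about points of a countable dense set,
    named through the code of their center. *)
Lemma polish_separating (R : realType) (X : topologicalType) : polish R X ->
  exists O : nat -> set X, (forall j, borel (O j)) /\
    forall x y, x <> y -> exists j, O j x /\ ~ O j y.
Proof.
move=> [[D /countable_injP[code codeI] denseD] [M [f [g [fK gK cf cg _]]]]].
pose P i k x := exists d, [/\ D d, code d = i & mdist (f d) (f x) < k.+1%:R^-1].
have openP i k : open [set x | P i k x].
  rewrite (_ : [set x | P i k x] = \bigcup_(d in [set d | D d /\ code d = i])
      [set x | mdist (f d) (f x) < k.+1%:R^-1]).
    by apply: bigcup_open => d _; exact: metric_ball_open.
  by apply/seteqP; split=> x /= [d]; [case=> *; exists d|case=> *; exists d].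
exists (fun j => if (unpickle j : option (nat * nat)) is Some (i, k)
                 then [set x | P i k x] else set0); split.
  move=> j; case: unpickle => [[i k]|]; apply: sub_gen_smallest => //.
  exact: open0.
move=> x y xy.
have xy0 : 0 < mdist (f x) (f y).
  by rewrite mdist_gt0; apply/eqP => /(can_inj fK).
(* The diameter of such a ball is then too small to contain both points. *)
pose k := Num.bound (2 / mdist (f x) (f y)).
have k_lt : 2 / k.+1%:R < mdist (f x) (f y).
  rewrite ltr_pdivrMr // mulrC -ltr_pdivrMr //.
  apply: (lt_le_trans (archi_boundP _)); first by rewrite divr_ge0 // ltW.
  by rewrite ler_nat.
have [|d [/= xd Dd]] := denseD _ _ (@metric_ball_open R M X f (f x) k.+1%:R^-1 cf).
  by exists x; rewrite /= mdistxx invr_gt0.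
exists (pickle (code d, k)); rewrite pickleK; split.
  by exists d; split=> //; rewrite metric_sym.
move=> [d' [Dd' /codeI]]; rewrite !inE => /(_ Dd' Dd) -> yd.
have := le_lt_trans (metric_triangle _ _ _) (ltrD xd yd).
by rewrite -mulr2n -[_ *+ 2]mulr_natl => /lt_trans/(_ k_lt); rewrite ltxx.
Qed.

Lemma continuous_borel (X Y : topologicalType) (f : X -> Y) : continuous f ->
  borel_fun f.
Proof.
move=> cf B bB; apply: (bB [set A | borel (f @^-1` A)]); split.
  split.
  - rewrite /= preimage_set0; exact: borel_const.
  - move=> A bA; rewrite /= setTD preimage_setC; exact: borel_not.
  - move=> F bF; rewrite /= preimage_bigcup; exact: sigma_algebra_bigcup.
move=> A oA; apply: sub_gen_smallest; exact: open_comp.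
Qed.

Lemma borel_action_section n (X : topologicalType) (a : 'rV[int]_n -> X -> X) :
  borel_action a -> forall g (B : set X), borel B -> borel [set x | B (a g x)].
Proof.
move=> ba g B /ba bB.
have cg : continuous (fun x : X => (g : discrete_topology 'rV[int]_n, x)).
  move=> x; apply: (@cvg_pair _ _ _ _ (nbhs (g : discrete_topology 'rV[int]_n)) (nbhs x)).
    exact: cvg_cst.
  exact: cvg_id.
exact: (continuous_borel cg bB).
Qed.

Lemma borel_funP (X : topologicalType) (c : X -> nat) :
  borel_fun c <-> borel_fibers c.
Proof.
split=> [bc t|bc B _]; last exact: (borel_preim B bc).
by apply: (bc [set t]); apply: sub_gen_smallest; exact: discrete_open.
Qed.

Lemma free_borel_action_colorable (R : realType) n (X : topologicalType)
  (a : 'rV[int]_n -> X -> X) : polish R X -> free_borel_action a ->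
  borel_colorable (schreier_graph a) (Some 3%N).
Proof.
move=> /polish_separating[U [bU sepU]] [acta fa /borel_action_section ba].
have [c [c3 cP bc]] := three_coloring acta fa ba bU sepU.
by exists c; split=> //; exact/borel_funP.
Qed.

Lemma borel_chromatic_number_le (X : topologicalType) (E : X -> X -> Prop) k :
  borel_colorable E (Some k) ->
  exists2 kappa, borel_chromatic_number E kappa & cardinal_le kappa (Some k).
Proof.
move=> colk; have ex : exists i, `[< borel_colorable E (Some i) >].
  by exists k; apply/asboolP.
case: (ex_minnP ex) => m /asboolP colm mmin.
have mle l : borel_colorable E (Some l) -> cardinal_le (Some m) (Some l).
  by move=> coll; rewrite /cardinal_le /= card_le_II; apply: mmin; apply/asboolP.
exists (Some m); last exact: mle.
split=> // -[l|_]; first exact: mle.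
exact: subset_card_le.
Qed.

(** * An action without Borel 2-colorings *)

Section BaireProperty.
Variable X : topologicalType.
Implicit Types A U : set X.

Definition residual A : Prop := exists F : nat -> set X,
  (forall i, open (F i) /\ dense (F i)) /\ \bigcap_i F i `<=` A.

Lemma residual_sub A B : A `<=` B -> residual A -> residual B.
Proof. by move=> AB [F [oF FA]]; exists F; split=> // x /FA /AB. Qed.

Lemma residual_bigcap (A : nat -> set X) :
  (forall i, residual (A i)) -> residual (\bigcap_i A i).
Proof.
move=> /choice[F FP].
exists (fun j => if (unpickle j : option (nat * nat)) is Some (i, k)
                 then F i k else setT); split.
  move=> j; case: unpickle => [[i k]|]; first by case: (FP i) => + _; apply.
  split; first exact: openT.
  by move=> O [x Ox] _; exists x.
move=> x xF i _; case: (FP i) => _; apply => k _.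
by have := xF (pickle (i, k)) I; rewrite pickleK.
Qed.

Lemma residualI A B : residual A -> residual B -> residual (A `&` B).
Proof.
move=> rA rB; apply: (@residual_sub (\bigcap_i if i is 0%N then A else B)).
  by move=> x h; split; [exact: (h 0%N I)|exact: (h 1%N I)].
by apply: residual_bigcap; case.
Qed.

Lemma residual_open_dense U : open U -> dense U -> residual U.
Proof. by move=> oU dU; exists (fun=> U); split=> // x /(_ 0%N I). Qed.

Definition baire_property A : Prop :=
  exists U, open U /\ residual [set x | A x <-> U x].

(** An open set together with the interior of its complement is open and dense, so that interior
    approximates the complement of [A]. *)
Lemma baire_propertyC A : baire_property A -> baire_property (~` A).
Proof.
move=> [U [oU rU]]; exists (~` U)^°; split; first exact: open_interior.
have rD : residual (U `|` (~` U)^°).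
  apply: residual_open_dense; first by apply: openU => //; exact: open_interior.
  move=> O [x Ox] oO; have [[y [Oy Uy]]|nOU] := EM (exists y, O y /\ U y).
    by exists y; split=> //; left.
  exists x; split=> //; right.
  rewrite /interior /=; apply: (filterS _ (open_nbhs_nbhs (conj oO Ox))).
  by move=> y Oy Uy; apply: nOU; exists y.
apply: residual_sub (residualI rU rD) => x [AU [Ux|nUx]] /=; split.
- by move=> nA; case: nA; apply/AU.
- by move=> /interior_subset.
- by [].
- by move=> _ /AU; exact: (interior_subset nUx).
Qed.

Lemma baire_property_bigcup (A : nat -> set X) :
  (forall i, baire_property (A i)) -> baire_property (\bigcup_i A i).
Proof.
move=> /choice[U UP]; exists (\bigcup_i U i); split.
  by apply: bigcup_open => i _; case: (UP i).
apply: residual_sub (residual_bigcap (fun i => proj2 (UP i))) => x h /=.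
by split=> -[i _ xi]; exists i => //; apply/(h i I).
Qed.

(** The sets with the Baire property form a sigma-algebra containing the open sets. *)
Lemma borel_baire_property A : borel A -> baire_property A.
Proof.
move=> bA; apply: (bA baire_property); split.
  split=> [|B bB|F bF].
  - exists set0; split; first exact: open0.
    by exists (fun=> setT); split=> // i; split; [exact: openT|move=> O [x Ox] _; exists x].
  - by rewrite setTD; exact: baire_propertyC.
  - exact: baire_property_bigcup.
move=> U oU; exists U; split=> //.
by exists (fun=> setT); split=> // i; split; [exact: openT|move=> O [x Ox] _; exists x].
Qed.

End BaireProperty.

(** * Translations of the real line and rational independence *)

Section RealTranslations.
Variable R : realType.
Implicit Types t x : R^o.

Lemma translation_continuous t : continuous (fun x : R^o => x + t).
Proof. by move=> x; apply: cvgD; [exact: cvg_id|exact: cvg_cst]. Qed.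

Lemma translation_open (A : set R^o) t : open A -> open [set x | A (x + t)].
Proof.
move=> oA; apply: (@open_comp R^o R^o (fun x => x + t) A) => // x _.
exact: translation_continuous.
Qed.

Lemma residual_translation (A : set R^o) t :
  residual A -> residual [set x | A (x + t)].
Proof.
move=> [F [oF FA]]; exists (fun i => [set x | F i (x + t)]); split=> [i|x h].
  have [oFi dFi] := oF i; split.
    exact: translation_open.
  move=> O [x Ox] oO.
  have oOt : open [set y : R^o | O (y + - t)] := translation_open oO.
  have Oxt : [set y : R^o | O (y + - t)] !=set0 by exists (x + t); rewrite /= addrK.
  have [y [Oy Fy]] := dFi _ Oxt oOt.
  by exists (y - t); split=> //=; rewrite subrK.
by apply: FA => i _; exact: h.
Qed.

(** If [A] is generically equal to a nonempty open [U], then for small [t] the set [U] meets its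
    translate, and a generic [x] there has both [x] and [x + t] in [A]. *)
Lemma baire_translation (A : set R^o) : borel A ->
  exists2 e : R, 0 < e & forall t, `|t| < e ->
    ~ (forall x, A (x + t) <-> ~ A x).
Proof.
move=> /borel_baire_property[U [oU rU]].
have [[x0 Ux0]|nU] := EM (exists x, U x).
  have /nbhs_ballP[e /= e0 eU] : nbhs x0 U by apply: open_nbhs_nbhs.
  exists e => // t te flip.
  have rV := residualI rU (residual_translation t rU).
  have oUt := translation_open (t := t) oU.
  move: rV => [F [oF FV]].
  have [||x [[Ux Ut] /FV[/= Ax At]]] := @Baire R R^o F oF (U `&` [set x | U (x + t)]).
  - exists x0; split=> //=; apply: eU.
    by rewrite /ball /= opprD addNKr normrN.
  - exact: openI.
  by apply: (proj1 (flip x)); [apply/At|apply/Ax].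
(* Here [U] is empty and [A] is meager: for a generic [x], neither [x] nor [x + t] is in [A], so no
   translation can swap [A] with its complement. *)
exists 1 => // t _ flip.
move: (residualI rU (residual_translation t rU)) => [F [oF FV]].
have [||x [_ /FV[/= Ax At]]] := @Baire R R^o F oF setT.
- by exists 0.
- exact: openT.
have nA y : (A y <-> U y) -> ~ A y by move=> AU /AU Uy; apply: nU; exists y.
by case: (nA _ At); apply/flip; exact: nA.
Qed.

Lemma polish_real : polish R R^o.
Proof.
split.
  exists (range (@ratr R)); last exact: dense_rat.
  by apply: (@card_le_trans _ _ _ [set: rat]); [exact: card_image_le|exact: countableP].
exists R^o, id, id; split=> //; try by move=> x; exact: cvg_id.
by move=> F PF cF; exists (lim F); exact: cauchy_cvg.
Qed.

(** Otherwise the unit interval would be countable and have Lebesgue measure 0. *)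
Lemma not_in_countable_range (T : countType) (f : T -> R) :
  exists b, forall u, f u <> b.
Proof.
apply: contrapT => h.
have cT : countable [set: R].
  apply: (@sub_countable _ _ _ (f @` setT)).
    apply: subset_card_le => b _; apply: contrapT => hb; apply: h; exists b.
    by move=> u fu; apply: hb; exists u.
  by apply: (@card_le_trans _ _ _ [set: T]); [exact: card_image_le|exact: countableP].
have c01 : countable (`[0, 1]%classic : set R).
  by apply: (sub_countable _ cT); exact: subset_card_le.
have := countable_lebesgue_measure0 c01.
rewrite lebesgue_measure_itv /= lte_fin ltr01 => /eqP.
by rewrite oppr0 adde0 eqe oner_eq0.
Qed.

Lemma rationally_independent_sequence n : exists al : nat -> R,
  forall g : nat -> int, \sum_(i < n) (g i)%:~R * al i = 0 ->
  forall i, (i < n)%N -> g i = 0.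
Proof.
elim: n => [|n [al IH]]; first by exists (fun=> 0).
(* The next real avoids all rational combinations of the earlier ones, encoded by integer numerators
   and a common denominator. *)
have [b bP] := @not_in_countable_range (seq int * int)%type
  (fun p => - (\sum_(i < n) (nth 0 p.1 i)%:~R * al i) / p.2%:~R).
exists (fun i => if (i < n)%N then al i else b) => g.
rewrite big_ord_recr /= ltnn.
rewrite (eq_bigr (fun i : 'I_n => (g i)%:~R * al i)); last by move=> i _; rewrite ltn_ord.
move=> sum0; have gn : g n = 0.
  apply/eqP/negPn/negP => gn0; apply: (bP (mkseq g n, g n)) => /=.
  rewrite (eq_bigr (fun i : 'I_n => (g i)%:~R * al i)); last first.
    by move=> i _; rewrite nth_mkseq.
  move/eqP: sum0; rewrite addrC addr_eq0 => /eqP <-.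
  by rewrite mulrC mulKf // intr_eq0.
move: sum0; rewrite gn mul0r addr0 => /IH h i; rewrite ltnS leq_eqVlt.
by move=> /predU1P[->//|]; exact: h.
Qed.

Definition displacement n (al : 'I_n -> R) (g : 'rV[int]_n) : R :=
  \sum_i (g 0 i)%:~R * al i.

Lemma displacementD n (al : 'I_n -> R) g h :
  displacement al (g + h) = displacement al g + displacement al h.
Proof.
by rewrite /displacement -big_split /=; apply: eq_bigr => i _; rewrite mxE intrD mulrDl.
Qed.

Lemma displacementZ n (al : 'I_n -> R) (k : int) g :
  displacement al (k *: g) = k%:~R * displacement al g.
Proof.
by rewrite /displacement mulr_sumr; apply: eq_bigr => i _; rewrite mxE intrM mulrA.
Qed.

Lemma displacement_delta n (al : 'I_n -> R) i :
  displacement al (delta_mx 0 i) = al i.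
Proof.
rewrite /displacement (bigD1 i) //= big1 ?addr0 ?mxE ?eqxx ?mul1r // => j ji.
by rewrite mxE eqxx (negbTE ji) mul0r.
Qed.

Lemma rationally_independent_reals n : exists al : 'I_n -> R,
  forall g, displacement al g = 0 -> g = 0.
Proof.
have [al alP] := rationally_independent_sequence n.
exists (fun i => al i) => g g0; apply/rowP => i; rewrite mxE.
pose g' j := if insub j is Some i then g 0 i else 0.
have g'E (j : 'I_n) : g' j = g 0 j by rewrite /g' valK.
rewrite -g'E; apply: alP => //; rewrite -[RHS]g0; apply: eq_bigr => j _.
by rewrite g'E.
Qed.

(** Dirichlet's pigeonhole argument on two coordinates gives a nonzero small displacement; doubling
    makes its group element even. Reducing the odd generator [delta_mx 0 i0] modulo it leaves a
    small remainder and keeps the parity odd. *)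
Lemma small_odd_displacement n (al : 'I_n -> R) (e : R) : (2 <= n)%N ->
  (forall g, displacement al g = 0 -> g = 0) -> 0 < e ->
  exists g, parity g /\ `|displacement al g| < e.
Proof.
move=> n2 indep e0.
pose i0 : 'I_n := Ordinal (ltnW n2); pose i1 : 'I_n := Ordinal n2.
have al0 : al i0 != 0.
  apply/eqP => h; have /indep/rowP/(_ i0) : displacement al (delta_mx 0 i0) = 0.
    by rewrite displacement_delta.
  by rewrite !mxE !eqxx.
pose N := Num.bound (2 * `|al i0| / e).
have N_large : 2 * `|al i0| / N.+1%:R < e.
  rewrite ltr_pdivrMr // [ltRHS]mulrC -ltr_pdivrMr //.
  apply: (lt_le_trans (archi_boundP _)); last by rewrite ler_nat.
  by rewrite divr_ge0 ?mulr_ge0 // ltW.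
pose u := al i1 / al i0.
pose fl (k : nat) : int := Num.floor (k%:R * u).
pose fr (k : nat) : R := k%:R * u - (fl k)%:~R.
have fr01 k : 0 <= fr k < 1.
  have := real_floor_itv (num_real (k%:R * u)); rewrite intrD => /andP[h1 h2].
  by rewrite subr_ge0 h1 ltrBlDl.
(* [N + 2] fractional parts fall into [N + 1] intervals of length [1 / (N + 1)]. *)
pose cell (k : 'I_N.+2) : 'I_N.+1 := inord (Num.truncn (N.+1%:R * fr k)).
have cellE k : (Num.truncn (N.+1%:R * fr k) < N.+1)%N.
  rewrite -(ltr_nat R); have /andP[fr0 fr1] := fr01 k.
  have /andP[h _] := truncn_itv (mulr_ge0 (ler0n R N.+1) fr0).
  by apply: (le_lt_trans h); rewrite gtr_pMr.
have /injectivePn[k [l kl eq_kl]] : ~~ injectiveb cell.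
  by apply/negP => /injectiveP/leq_card; rewrite !card_ord ltnn.
have fr_close : `|fr k - fr l| < N.+1%:R^-1.
  move: eq_kl => /(congr1 val) /=; rewrite !inordK // => eq_kl.
  have /andP[fk0 _] := fr01 k; have /andP[fl0 _] := fr01 l.
  have /andP[k1 k2] := truncn_itv (mulr_ge0 (ler0n R N.+1) fk0).
  have /andP[l1 l2] := truncn_itv (mulr_ge0 (ler0n R N.+1) fl0).
  rewrite -(ltr_pM2l (ltr0Sn R N)) mulfV ?pnatr_eq0 //.
  rewrite -[X in X * _](ger0_norm (ler0n R N.+1)) -normrM mulrBr.
  move: k1 k2 l1 l2; rewrite eq_kl -natr1.
  by move=> k1 k2 l1 l2; rewrite ltr_norml; apply/andP; split; lra.
(* Its displacement is [al i0 * (fr k - fr l)], and its coordinate at [i1] is nonzero because [k]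
   and [l] differ. *)
pose h : 'rV[int]_n := (k%:Z - l%:Z) *: delta_mx 0 i1 - (fl k - fl l) *: delta_mx 0 i0.
pose t := displacement al (2 *: h).
have tE : t = 2 * al i0 * (fr k - fr l).
  rewrite /t displacementZ displacementD -scaleNr !displacementZ !displacement_delta.
  rewrite /fr /u !intrD !intrN -!pmulrn.
  by field.
have t0 : t != 0.
  apply/eqP => /indep /rowP /(_ i1).
  rewrite !mxE !eqxx /= mulr1 mulr0 subr0 => /eqP.
  rewrite mulf_eq0 /= subr_eq0 => /eqP [] kl'; move: kl.
  by rewrite -val_eqE /= kl' eqxx.
have te : `|t| < e.
  apply: le_lt_trans N_large; rewrite tE !normrM ger0_norm //.
  by apply: ler_wpM2l; [exact: mulr_ge0|exact: ltW].
pose m := Num.floor (al i0 / t).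
exists (delta_mx 0 i0 - m *: (2 *: h)); split.
  rewrite parityD parityN parity_delta scalerA mulrC -scalerA.
  by rewrite -[2]/(1 + 1) scalerDl !scale1r parityD addbb.
apply: le_lt_trans te.
rewrite displacementD -scaleNr displacementZ displacement_delta -/t.
have -> : al i0 + (- m)%:~R * t = (al i0 / t - m%:~R) * t.
  by rewrite mulrBl divfK // intrN mulNr.
rewrite normrM ler_piMl //.
have := real_floor_itv (num_real (al i0 / t)); rewrite intrD => /andP[h1 h2].
by rewrite ger0_norm ?subr_ge0 // lerBlDl ltW.
Qed.

End RealTranslations.

(** * The translation action *)

Section TranslationAction.
Variables (R : realType) (n : nat) (al : 'I_n -> R).

Definition translation (g : 'rV[int]_n) (x : R^o) : R^o := x + displacement al g.

Lemma translation_free_borel_action :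
  (forall g, displacement al g = 0 -> g = 0) -> free_borel_action translation.
Proof.
move=> indep; split.
- split=> [x|g h x]; last by rewrite /translation displacementD addrAC addrA.
  by rewrite /translation -(scale0r 0) displacementZ mul0r addr0.
- move=> g x /(canRL (addKr x)); rewrite addNr; exact: indep.
move=> B bB; pose D := discrete_topology 'rV[int]_n.
(* The acting group is countable, so the preimage is a countable union of slices over [g]. *)
have : borel [set p : D * R^o | exists g : 'rV[int]_n, p.1 = g /\ B (p.2 + displacement al g)].
  apply: borel_exists => g; apply: borel_and.
    apply: (@continuous_borel (D * R^o)%type D fst _ [set g]).
      by move=> p; exact: cvg_fst.
    by apply: sub_gen_smallest; exact: discrete_open.
  apply: (@continuous_borel (D * R^o)%type R^o (fun p => p.2 + displacement al g) _ B bB).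
  by move=> p; apply: cvgD; [exact: cvg_snd|exact: cvg_cst].
congr (borel _); apply/seteqP; split=> p /=; first by move=> [g [<-]].
by exists p.1.
Qed.

(** Each generator swaps the two colors, and the elements acting on colors by their parity are
    closed under sums. *)
Lemma proper_two_coloring_parity (X : topologicalType) (a : 'rV[int]_n -> X -> X)
  (c : X -> nat) : is_action a -> (forall x, (c x < 2)%N) ->
  proper_coloring (schreier_graph a) c ->
  forall g x, (c (a g x) == 0%N) = (c x == 0%N) (+) parity g.
Proof.
move=> [a0 aD] c2 cP.
pose flips g := forall x, (c (a g x) == 0%N) = (c x == 0%N) (+) parity g.
have flipsD g h : flips g -> flips h -> flips (g + h).
  by move=> fg fh x; rewrite aD fg fh parityD -addbA [parity h (+) _]addbC.
have flips0 : flips 0.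
  move=> x; rewrite a0; have := parityD (0 : 'rV[int]_n) 0.
  by rewrite addr0 addbb => ->; rewrite addbF.
have flipsS s : standard_generator s -> flips s.
  move=> gs x; rewrite (standard_generator_parity gs) addbT.
  have /cP : schreier_graph a x (a s x) by exists s.
  by move: (c2 x) (c2 (a s x)); case: (c x) => [|[]//]; case: (c _) => [|[]//].
have flipsZ i (k : int) : flips (k *: delta_mx 0 i).
  elim/int_ind: k => [|k IH|k IH]; first by rewrite scale0r.
    rewrite intS addrC scalerDl scale1r; apply: flipsD => //.
    by apply: flipsS; exists i; left.
  rewrite intS opprD addrC scalerDl scaleN1r; apply: flipsD => //.
  by apply: flipsS; exists i; right.
move=> g; rewrite [g]row_sum_delta.
by apply: (big_ind flips) => // i _; exact: flipsZ.
Qed.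

Lemma translation_not_two_colorable : (2 <= n)%N ->
  (forall g, displacement al g = 0 -> g = 0) ->
  ~ borel_colorable (schreier_graph translation) (Some 2%N).
Proof.
move=> n2 indep [c [/= c2 cP bc]].
have [act _ _] := translation_free_borel_action indep.
have parityP := proper_two_coloring_parity act c2 cP.
have bA : borel [set x : R^o | c x = 0%N] by move/borel_funP: bc => /(_ 0%N).
have [e e0 eP] := baire_translation bA.
have [g [odd_g ge]] := small_odd_displacement n2 indep e0.
apply: (eP _ ge) => x /=.
by move: (parityP g x); rewrite odd_g addbT; case: eqP; case: eqP.
Qed.

End TranslationAction.

Local Close Scope ring_scope.
Local Close Scope classical_set_scope.

Theorem theorem1p1 (R : realType) (n : nat) (hn : (2 <= n)%N) :
  (forall (X : topologicalType) (a : 'rV[int]_n -> X -> X),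
      polish R X -> free_borel_action a ->
      exists2 kappa : countable_cardinal,
        borel_chromatic_number (schreier_graph a) kappa &
        cardinal_le kappa (Some 3)) /\
  (exists (X : topologicalType) (a : 'rV[int]_n -> X -> X),
      [/\ polish R X, free_borel_action a &
        borel_chromatic_number (schreier_graph a) (Some 3)]).
Proof.
have chi_le3 (X : topologicalType) (a : 'rV[int]_n -> X -> X) (pX : polish R X)
  (fa : free_borel_action a) := borel_chromatic_number_le
    (free_borel_action_colorable pX fa).
split=> //.
have [al indep] := rationally_independent_reals R n.
have fa := translation_free_borel_action indep.
exists R^o, (translation al); split=> //; first exact: polish_real.
have [kappa chi le3] := chi_le3 _ _ (polish_real R) fa.
(* The infinite cardinal does not embed into 3, and a finite value below 3 would give a Borel
   2-coloring. *)
case: kappa chi le3 => [k|] chi; rewrite /cardinal_le /=; last first.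
  move=> le3; exfalso; apply: infinite_nat.
  exact: (card_le_finite le3 (finite_II 3)).
rewrite card_le_II leq_eqVlt => /predU1P[<-//|]; rewrite ltnS => k2.
have [[c [ck cP bc]] _] := chi.
case: (translation_not_two_colorable hn indep); exists c; split=> // x.
exact: leq_trans (ck x) k2.
Qed.
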